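(* Let $\mathcal{D}$ be a quasi-symmetric $2$-$(v,k,\lambda)$ design with replication number $r$, $b$ blocks and two block intersection sizes $x\neq y$ (with no assumption on which is larger), and let $\Gamma_2$ be its block graph in which two blocks are adjacent if they intersect in $y$ points, a strongly regular graph with parameters $(b,a,c,d)$. Let $\Gamma$ be the graph whose vertex set is the disjoint union of the set $V_1$ of points and the set $V_2$ of blocks of $\mathcal{D}$, where no two points are adjacent (the induced subgraph on $V_1$ is empty), a point is adjacent to a block if and only if they are incident, and the induced subgraph on $V_2$ is $\Gamma_2$. Suppose that $\Gamma$ is biregular with valency partition $(V_1,V_2)$. Let $\theta_1,\theta_2$ be real numbers. Then $\Gamma$ has three distinct $\mathcal{L}$-eigenvalues $0,\theta_1,\theta_2$ if and only if $$\begin{array}{rcl} \frac{r}{k+a}&=&tr^2-(\theta_1-1)(\theta_2-1)r,\\ \frac{\lambda}{k+a}&=&tr^2,\\ \frac kr+\frac{a}{k+a}&=&t(k+a)^2-(\theta_1-1)(\theta_2-1)(k+a),\\ \frac{x}{r}+\frac{d}{k+a}&=&t(k+a)^2,\\ \frac{y}{r}+\frac{c}{k+a}&=&t(k+a)^2+2-\theta_1-\theta_2,\\ \frac{\lambda k-xr}{(y-x)(k+a)}&=&tr(k+a),\\ \frac{(\lambda-1)(k-1)-(x-1)(r-1)}{(y-x)(k+a)}&=&tr(k+a)+2-\theta_1-\theta_2, \end{array}$$ where $t=\frac{\theta_1\theta_2}{vr+b(k+a)}$.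
   Context: All graphs are finite, simple and undirected. $d_u$ denotes the valency (degree) of vertex $u$. The normalized Laplacian of a graph is the matrix $\mathcal{L}=[\ell_{uv}]$ indexed by the vertices with $\ell_{uu}=1$ if $d_u\neq 0$, $\ell_{uv}=-1/\sqrt{d_ud_v}$ if $u$ and $v$ are adjacent, and $\ell_{uv}=0$ otherwise. Its eigenvalues are called the $\mathcal{L}$-eigenvalues of the graph. A graph is biregular if exactly two distinct valencies occur; the valency partition is the partition of the vertex set according to valencies. A $2$-$(v,k,\lambda)$ design ($2\le k<v$, $\lambda\ge1$) has $v$ points and a collection of $b$ blocks (repeated blocks allowed), each block incident with $k$ points, such that any two distinct points are in exactly $\lambda$ common blocks; each point is then in $r=\lambda\frac{v-1}{k-1}$ blocks and $b=\frac{vr}{k}$. It is quasi-symmetric with block intersection sizes $x\neq y$ if any two distinct blocks meet in $x$ or $y$ points, both sizes occurring. A graph is strongly regular with parameters $(n,k',\lambda',\mu')$ if it has $n$ vertices, is $k'$-regular with $0<k'<n-1$, and any two distinct vertices have $\lambda'$ common neighbors if adjacent and $\mu'$ otherwise. The block graph $\Gamma_2$ of a quasi-symmetric design (blocks adjacent when they meet in $y$ points) is strongly regular with parameters $(b,a,c,d)$, where $a=\frac{(r-1)k-x(b-1)}{y-x}$, $d=a+\rho_1\rho_2$, $c=d+\rho_1+\rho_2$, with $\rho_1=\frac{r-\lambda-k+x}{y-x}$ and $\rho_2=\frac{x-k}{y-x}$. For a point-block pair $(P,B)$, the number of blocks $B'\neq B$ incident with $P$ and meeting $B$ in $y$ points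 equals $\frac{(\lambda-1)(k-1)-(x-1)(r-1)}{y-x}$ if $P$ is incident with $B$, and $\frac{\lambda k-xr}{y-x}$ otherwise. *)

(* Defs.v *)
From HB Require Import structures.
From mathcomp Require Import all_boot all_order all_algebra.
From mathcomp Require Import reals.

Set Implicit Arguments.
Unset Strict Implicit.
Unset Printing Implicit Defensive.

Import Order.TTheory GRing.Theory Num.Theory.

Record sgraph (T : finType) := SGraph {
  adj :> rel T;
  adj_sym : symmetric adj;
  adj_irrefl : irreflexive adj
}.

Section Graphs.
Variables (T : finType) (G : sgraph T).

Definition valency (u : T) : nat := #|[set w | G u w]|.

Definition common_neighbors (u w : T) : {set T} := [set z | G u z && G w z].

Definition valency_partition : {set {set T}} := preim_partition valency [set: T].

Definition biregular : Prop := size (undup (codom valency)) = 2.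

Definition strongly_regular (n k l m : nat) : Prop :=
  [/\ #|T| = n, 0 < k < n.-1, forall u, valency u = k
    & forall u w, u != w -> #|common_neighbors u w| = if G u w then l else m].

(* Rows and columns are indexed by the vertices through [enum_val]. *)
Definition normalized_laplacian (R : realType) : 'M[R]_#|T| :=
  \matrix_(i, j)
    (let u := enum_val i in
     let w := enum_val j in
     if u == w then (if valency u != 0 then 1 else 0)
     else if G u w then - (1 / Num.sqrt ((valency u)%:R * (valency w)%:R))
     else 0)%R.

(* The entries of [s] are pairwise distinct and are exactly the eigenvalues of
   the normalized Laplacian. This matrix is real symmetric, so that its
   eigenvalues in [R] are all its eigenvalues. *)
Definition distinct_Leigenvalues (R : realType) (s : seq R) : Prop :=
  uniq s /\ eigenvalue (normalized_laplacian R) =i s.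

End Graphs.

(* Blocks form a type of their own rather than a set of subsets of the points,
   so repeated blocks are allowed. *)
Section Designs.
Variables (P B : finType) (inc : P -> B -> bool).

Definition block_points (D : B) : {set P} := [set p | inc p D].

Definition point_blocks (p : P) : {set B} := [set D | inc p D].

Definition is_2design (v k l : nat) : Prop :=
  [/\ #|P| = v, 2 <= k < v, 1 <= l, forall D, #|block_points D| = k
    & forall p q, p != q -> #|point_blocks p :&: point_blocks q| = l].

Definition replication_number (r : nat) : Prop := forall p, #|point_blocks p| = r.

Definition meet_size (D E : B) : nat := #|block_points D :&: block_points E|.

Definition quasi_symmetric (x y : nat) : Prop :=
  [/\ x <> y,
      forall D E, D != E -> meet_size D E = x \/ meet_size D E = y,
      exists D E, D != E /\ meet_size D E = x
    & exists D E, D != E /\ meet_size D E = y].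

Definition block_adj (y : nat) : rel B :=
  fun D E => (D != E) && (meet_size D E == y).

Lemma block_adj_sym y : symmetric (block_adj y).
Proof. by move=> D E; rewrite /block_adj /meet_size eq_sym setIC. Qed.

Lemma block_adj_irrefl y : irreflexive (block_adj y).
Proof. by move=> D; rewrite /block_adj eqxx. Qed.

Definition block_graph (y : nat) : sgraph B :=
  SGraph (block_adj_sym y) (@block_adj_irrefl y).

Definition point_block_adj (y : nat) : rel (P + B)%type := fun u w =>
  match u, w with
  | inl _, inl _ => false
  | inl p, inr D => inc p D
  | inr D, inl p => inc p D
  | inr D, inr E => block_graph y D E
  end.

Lemma point_block_adj_sym y : symmetric (point_block_adj y).
Proof. by move=> [p|D] [q|E] //=; rewrite block_adj_sym. Qed.

Lemma point_block_adj_irrefl y : irreflexive (point_block_adj y).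
Proof. by move=> [p|D] //=; rewrite block_adj_irrefl. Qed.

Definition point_block_graph (y : nat) : sgraph (P + B)%type :=
  SGraph (point_block_adj_sym y) (@point_block_adj_irrefl y).

End Designs.

Definition point_part (P B : finType) : {set P + B} := [set inl p | p : P].

Definition block_part (P B : finType) : {set P + B} := [set inr D | D : B].

(* Main.v *)
(* Let w be the row vector of square roots of the valencies. In a connected graph w
   spans the kernel of the normalized Laplacian L (its quadratic form is a sum of
   squares over the edges), so, L being symmetric, a spectrum {0, theta1, theta2}
   forces (L - theta1)(L - theta2) = (theta1 theta2 / w w^T) w^T w. Conversely this
   matrix identity leaves no other eigenvalue, and if theta1, theta2 were not
   distinct, nonzero and both attained, L would act as a scalar on the orthogonal
   complement of w; then all off-diagonal entries of L would vanish or none would,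
   which is impossible for a connected noncomplete graph. Read entry by entry, the
   identity prescribes the sum of 1/d_z over the common neighbours z of u and u' in
   terms of d_u, d_u' and whether u, u' are equal or adjacent; in a point-block graph
   the seven types of pairs (u, u') give the seven equations. *)
Require Import Defs.
From HB Require Import structures.
From mathcomp Require Import all_boot all_order all_algebra.
From mathcomp Require Import reals.
From mathcomp Require Import complex ring lra.
Import Order.TTheory GRing.Theory Num.Theory.
Local Open Scope ring_scope.

Set Implicit Arguments.
Unset Strict Implicit.
Unset Printing Implicit Defensive.

(** * Annihilating polynomial of a real symmetric matrix *)

(** Over [R[i]] the matrix is Hermitian, hence unitarily diagonalizable with real diagonal entries.
    Each entry is an eigenvalue of [A], so it lies in [s]; up to conjugation the product is
    therefore a diagonal matrix with a zero factor in every position. *)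
Lemma sym_annihilator {R : rcfType} {n} {A : 'M[R]_n} {s : seq R} :
  A^T = A -> (forall a, eigenvalue A a -> a \in s) ->
  \big[mulmx/1%:M]_(a <- s) (A - a%:M) = 0.
Proof.
move=> symA eigA; pose B : 'M[R[i]]_n := map_mx (real_complex R) A.
have realB : B \is a mxOver Num.real.
  by apply/mxOverP => i j; rewrite mxE complex_real.
have symB : B \is symmetricmx.
  apply/is_hermitianmxP; rewrite expr0 scale1r map_mx_id //.
  by rewrite /B map_trmx symA.
have hermB := realsym_hermsym symB realB.
have unitP := spectral_unit B.
have defB := orthomx_spectralP (hermitian_normalmx hermB).
have real_d := hermitian_spectral_diag_real hermB.
set Q := spectralmx B in unitP defB; set d := spectral_diag B in defB real_d.
have d_in i : exists2 a, a \in s & d 0 i = a%:C%C.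
  have /complex_realP [a da] := mxOverP real_d 0 i.
  exists a => //; apply: eigA; rewrite eigenvalue_root_char.
  (* The characteristic polynomial carries eigenvalues from [R] to [R[i]]; there row [i] of the
     invertible matrix [Q] is a left eigenvector. *)
  rewrite -(fmorph_root (real_complex R)) map_char_poly -/B /= -da.
  rewrite -eigenvalue_root_char; apply/eigenvalueP; exists (row i Q).
    rewrite {1}defB -row_mul !mulmxA mulmxV // mul1mx row_mul row_diag_mx.
    by rewrite -scalemxAl -rowE.
  apply/eqP => /(congr1 (mulmx^~ (invmx Q))); rewrite -row_mul mulmxV // mul0mx.
  by rewrite row1 => /rowP /(_ i) /eqP; rewrite !mxE !eqxx oner_eq0.
apply: (@map_mx_inj _ _ (real_complex R)).
have prodE (s' : seq R) :
   map_mx (real_complex R) (\big[mulmx/1%:M]_(a <- s') (A - a%:M))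
   = invmx Q *m diag_mx (\row_i \prod_(a <- s') (d 0 i - a%:C%C)) *m Q.
  elim: s' => [|a s' IHs].
    rewrite big_nil map_mx1 (_ : \row_i _ = const_mx 1).
      by rewrite diag_const_mx mulmx1 mulVmx.
    by apply/rowP => i; rewrite !mxE big_nil.
  rewrite big_cons map_mxM /= IHs map_mxB map_scalar_mx -/B /=.
  have -> : B - (a%:C%C)%:M = invmx Q *m diag_mx (\row_i (d 0 i - a%:C%C)) *m Q.
    rewrite (_ : \row_i _ = d - const_mx a%:C%C).
      rewrite raddfB /= diag_const_mx mulmxBr mulmxBl -defB mul_mx_scalar.
      by rewrite -scalemxAl mulVmx // scalemx1.
    by apply/rowP => i; rewrite !mxE.
  rewrite -!mulmxA (mulmxA Q) mulmxV // mul1mx (mulmxA (diag_mx _)) mulmx_diag.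
  congr (_ *m (diag_mx _ *m _)).
  by apply/rowP => i; rewrite !mxE big_cons.
rewrite prodE map_mx0 (_ : \row_i _ = 0) ?raddf0 ?mulmx0 ?mul0mx //.
apply/rowP => i; rewrite !mxE; have [a sa ->] := d_in i.
by rewrite (big_rem a) //= subrr mul0r.
Qed.

(** * The spectrum [{0, th1, th2}] as a quadratic matrix identity *)

Section ThreeEigenvalues.
Variables (R : rcfType) (n : nat) (A : 'M[R]_n) (w : 'rV[R]_n) (s th1 th2 : R).
Hypotheses (symA : A^T = A) (wA : w *m A = 0) (kerA : (kermx A <= w)%MS).
Hypotheses (ww : w *m w^T = s%:M) (s0 : s != 0).

Let Awt : A *m w^T = 0.
Proof. by rewrite -{1}symA -trmx_mul wA trmx0. Qed.

Let scalar0E : 0%:M = 0 :> 'M[R]_n.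
Proof. exact: raddf0. Qed.

Let shiftC (a b : R) : (A - a%:M) *m (A - b%:M) = (A - b%:M) *m (A - a%:M).
Proof.
rewrite !mulmxBl !mulmxBr -!scalar_mxM !scalar_mxC (mulrC a).
by rewrite !opprB addrACA [RHS]addrACA; congr (_ + _); rewrite addrC.
Qed.

(** The left side [M] is killed by [A] on both sides, so its rows are multiples of [w], that is
    [M = C w]. Applying [M] to [w^T] gives [s C = th1 th2 w^T]. *)
Lemma three_eigenvalues_mxeq :
  (forall a, eigenvalue A a -> a \in [:: 0; th1; th2]) ->
  (A - th1%:M) *m (A - th2%:M) = (th1 * th2 / s) *: (w^T *m w).
Proof.
move=> eigA; have := sym_annihilator symA eigA.
rewrite !big_cons big_nil mulmx1; set M := _ *m (A - th2%:M) => AM0.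
have MA0 : M *m A = 0.
  by rewrite -[A in M *m A]subr0 -scalar0E /M -mulmxA shiftC mulmxA shiftC -mulmxA AM0.
have /submxP[C defM] : (M <= w)%MS.
  by apply: submx_trans kerA; apply/sub_kermxP.
have : M *m w^T = (th1 * th2) *: w^T.
  have shift_wt e : (A - e%:M) *m w^T = - e *: w^T.
    by rewrite mulmxBl Awt sub0r mul_scalar_mx scaleNr.
  by rewrite /M -mulmxA shift_wt -scalemxAr shift_wt scalerA mulrNN mulrC.
rewrite defM -mulmxA ww mul_mx_scalar => /(congr1 ( *:%R s^-1)).
by rewrite !scalerA mulVf // scale1r => ->; rewrite -scalemxAl mulrC.
Qed.

(* [A] does not act as a scalar on the orthogonal complement of [w]. *)
Hypothesis nonclique : forall mu c, A - mu%:M != c *: (w^T *m w).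

(** [Pi] is the orthogonal projection onto the complement of [w]. If [Pi (A - mu)] vanished,
    [w A = 0] would turn [A - mu] into [- (mu / s) w^T w], against [nonclique]. *)
Let perp_noneigen mu : exists2 u : 'rV_n, u *m w^T = 0 & u *m (A - mu%:M) != 0.
Proof.
pose Pi : 'M_n := 1%:M - s^-1 *: (w^T *m w).
have Piw : Pi *m w^T = 0.
  rewrite mulmxBl mul1mx -scalemxAl -mulmxA ww mul_mx_scalar scalerA.
  by rewrite mulVf // scale1r subrr.
have : Pi *m (A - mu%:M) != 0.
  apply/eqP => Pi0; have /eqP := nonclique mu (- mu / s); apply.
  have := Pi0; rewrite mulmxBl mul1mx => /eqP; rewrite subr_eq0 => /eqP ->.
  rewrite -scalemxAl -mulmxA mulmxBr wA sub0r mul_mx_scalar mulmxN.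
  by rewrite -scalemxAr scalerN scalerA -scaleNr mulNr mulrC.
case/rowV0Pn => u /submxP[D ->] u0; exists (D *m Pi).
  by rewrite -mulmxA Piw mulmx0.
by rewrite -mulmxA.
Qed.

(** Pushing a suitable [u] orthogonal to [w] through [A - a] yields a nonzero [b]-eigenvector [u'],
    again orthogonal to [w]. Either degenerate case, [b = 0] or [a = b], would make the squared norm
    of [u'] zero. *)
Let mxeq_factor (a b : R) :
  (A - a%:M) *m (A - b%:M) = (a * b / s) *: (w^T *m w) ->
  [/\ b != 0, a != b & eigenvalue A b].
Proof.
move=> mxeq; have [u uw u'0] := perp_noneigen a.
set u' := u *m _ in u'0.
have u'b : u' *m (A - b%:M) = 0.
  by rewrite -mulmxA mxeq -scalemxAr mulmxA uw mul0mx scaler0.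
have u'w : u' *m w^T = 0.
  by rewrite -mulmxA mulmxBl Awt mul_scalar_mx sub0r mulmxN -scalemxAr uw scaler0 oppr0.
have sq0 : u' *m u'^T = 0 -> False.
  move=> /matrixP /(_ 0 0); rewrite !mxE => /eqP; rewrite psumr_eq0; last first.
    by move=> i _; rewrite !mxE -expr2 sqr_ge0.
  move=> /allP z; case/eqP: u'0; apply/rowP => i; apply/eqP.
  by have := z i; rewrite mem_index_enum !mxE -expr2 sqrf_eq0 => /(_ isT).
split.
(* For [b = 0], [u'] lies in the kernel, hence is both a multiple of [w] and orthogonal to it. *)
- apply/eqP => b0; apply: sq0.
  have /submxP[C defu'] : (u' <= w)%MS.
    apply: submx_trans kerA; apply/sub_kermxP.
    by rewrite b0 scalar0E subr0 in u'b.
  by rewrite {2}defu' trmx_mul mulmxA u'w mul0mx.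
(* By symmetry of [A], the squared norm is [u' (A - a) u^T], and [u'] is killed by [A - b]. *)
- apply/eqP => ab; apply: sq0.
  rewrite /u' trmx_mul [(_ - _)^T]linearB /= symA tr_scalar_mx mulmxA ab.
  by rewrite -ab in u'b *; rewrite u'b mul0mx.
apply/eigenvalueP; exists u' => //.
by apply/eqP; rewrite -subr_eq0 -mul_mx_scalar -mulmxBr u'b.
Qed.

(** The two factors commute, so [mxeq_factor] applies in both orders. An eigenvector for [a != 0] is
    orthogonal to [w], which reduces the identity to [(a - th1)(a - th2) = 0]; [w] itself realizes
    the eigenvalue 0. *)
Lemma mxeq_three_eigenvalues :
  (A - th1%:M) *m (A - th2%:M) = (th1 * th2 / s) *: (w^T *m w) ->
  uniq [:: 0; th1; th2] /\ eigenvalue A =i [:: 0; th1; th2].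
Proof.
move=> mxeq; have [th2_0 th12 eig2] := mxeq_factor mxeq.
have [|th1_0 _ eig1] := @mxeq_factor th2 th1; first by rewrite shiftC mxeq (mulrC th1).
split; first by rewrite /= !inE !negb_or ![0 == _]eq_sym th1_0 th2_0 th12.
have w0 : w != 0.
  apply: contraNneq s0 => w0; have := ww; rewrite w0 mul0mx => /matrixP /(_ 0 0).
  by rewrite !mxE eqxx mulr1n => <-.
move=> a; rewrite !inE; apply/idP/idP => [/eigenvalueP[u uA u0]|].
  have [->//|a0 /=] := eqVneq a 0.
  have uw : u *m w^T = 0.
    apply: (scalerI a0); rewrite scaler0 scalemxAl -uA -mulmxA Awt mulmx0 //.
  have : u *m ((A - th1%:M) *m (A - th2%:M)) = 0.
    by rewrite mxeq -scalemxAr mulmxA uw mul0mx scaler0.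
  have shift b : u *m (A - b%:M) = (a - b) *: u.
    by rewrite mulmxBr uA mul_mx_scalar scalerBl.
  rewrite mulmxA shift -scalemxAl shift scalerA => /eqP.
  by rewrite scaler_eq0 (negPf u0) orbF mulf_eq0 !subr_eq0.
case/or3P => /eqP -> //; apply/eigenvalueP; exists w => //.
by rewrite wA scale0r.
Qed.

End ThreeEigenvalues.

(** * The normalized Laplacian of a connected noncomplete graph *)

Lemma sum_enum_rank (R : nmodType) (T : finType) (F : 'I_#|T| -> R) :
  \sum_i F i = \sum_u F (enum_rank u).
Proof. by rewrite (reindex enum_rank) //; apply: onW_bij; apply: enum_rank_bij. Qed.

Section NormalizedLaplacian.
Variables (R : realType) (T : finType) (G : sgraph T).
Hypothesis valency_gt0 : forall u, (0 < valency G u)%N.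

Local Notation deg u := ((valency G u)%:R : R).
Local Notation root u := (Num.sqrt (deg u)).
Local Notation L := (normalized_laplacian G R).

Let w : 'rV[R]_#|T| := \row_i root (enum_val i).

Let deg_gt0 u : 0 < deg u. Proof. by rewrite ltr0n. Qed.

Let root_neq0 u : root u != 0.
Proof. by rewrite gt_eqF // sqrtr_gt0. Qed.

Let sqr_root u : root u * root u = deg u.
Proof. by rewrite -expr2 sqr_sqrtr // ltW. Qed.

Let LE u z : L (enum_rank u) (enum_rank z)
  = (u == z)%:R - (G u z)%:R / (root u * root z).
Proof.
rewrite mxE /= !enum_rankK -lt0n valency_gt0.
case: eqP => [->|_]; first by rewrite adj_irrefl mul0r subr0.
case: (G u z); last by rewrite mul0r subr0.
by rewrite sqrtrM ?ltW // sub0r.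
Qed.

Let wE u : w 0 (enum_rank u) = root u.
Proof. by rewrite mxE enum_rankK. Qed.

Let wwE u z : (w^T *m w) (enum_rank u) (enum_rank z) = root u * root z.
Proof. by rewrite mxE big_ord1 mxE !wE. Qed.

Let sum_delta (F : T -> R) z : \sum_u F u * (u == z)%:R = F z.
Proof.
rewrite (bigD1 z) //= eqxx mulr1 big1 ?addr0 // => u /negPf ->.
by rewrite mulr0.
Qed.

Let sum_adj z : \sum_u (G u z)%:R = deg z.
Proof.
rewrite -natr_sum /valency -sum1_card [in RHS]big_mkcond /=.
by congr _%:R; apply: eq_bigr => u _; rewrite inE adj_sym; case: (G z u).
Qed.

Lemma normalized_laplacian_sym : L^T = L.
Proof.
apply/matrixP => i j; rewrite -(enum_valK i) -(enum_valK j) mxE !LE.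
by rewrite eq_sym adj_sym [root _ * _]mulrC.
Qed.

Let wL : w *m L = 0.
Proof.
apply/rowP => j; rewrite -(enum_valK j); set z := enum_val j.
rewrite !mxE sum_enum_rank.
under eq_bigr => u _ do rewrite wE LE mulrBr.
rewrite big_split /= sum_delta.
under eq_bigr => u _.
  rewrite (_ : - _ = (G u z)%:R * - (root z)^-1); first over.
  have := root_neq0 u; have := root_neq0 z; set a := root _; set b := root _ => ? ?.
  by field; apply/andP.
by rewrite -mulr_suml sum_adj -[X in _ + X * _]sqr_root mulrN mulfK ?subrr.
Qed.

Let ww : w *m w^T = (\sum_u deg u)%:M.
Proof.
rewrite [LHS]mx11_scalar mxE sum_enum_rank; congr _%:M; apply: eq_bigr => u _.
by rewrite [X in _ * X]mxE !wE sqr_root.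
Qed.

(* The Laplacian quadratic form is half the sum of the squares
   [(f u / root u - f z / root z)^2] over the ordered pairs of adjacent vertices. *)
Lemma normalized_laplacian_ker_adj (f : 'rV[R]_#|T|) u0 z0 : f *m L = 0 -> G u0 z0 ->
  f 0 (enum_rank u0) / root u0 = f 0 (enum_rank z0) / root z0.
Proof.
move=> fL adj0; pose g u := f 0 (enum_rank u) / root u.
have fE u : f 0 (enum_rank u) = g u * root u by rewrite /g divfK.
pose S := \sum_z \sum_u (G u z)%:R * (g u * g z).
(* This is [f L f^T = 0] written out with [f u = g u * root u]. *)
have SE : \sum_u deg u * g u ^+ 2 = S.
  apply/eqP; rewrite -subr_eq0 -[X in _ == X](_ : (f *m L *m f^T) 0 0 = 0); last first.
    by rewrite fL mul0mx mxE.
  rewrite mxE sum_enum_rank -sumrB; apply/eqP/eq_bigr => z _.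
  rewrite !mxE sum_enum_rank.
  under [in RHS]eq_bigr => u _ do rewrite LE mulrBr.
  rewrite big_split /= sum_delta mulrDl fE mulr_suml; congr (_ + _).
    by rewrite mulrACA sqr_root; ring.
  rewrite -sumrN; apply: eq_bigr => u _; rewrite fE.
  have := root_neq0 u; have := root_neq0 z; set a := root _; set b := root _ => ? ?.
  by field; apply/andP.
have Q0 : \sum_z \sum_u (G u z)%:R * (g u - g z) ^+ 2 = 0.
  have expand u z : (G u z)%:R * (g u - g z) ^+ 2 = (G u z)%:R * g u ^+ 2
      + (G u z)%:R * g z ^+ 2 - 2 * ((G u z)%:R * (g u * g z)) by ring.
  (* Both square terms sum to [S] by [SE], the cross term to [- 2 S]. *)
  under eq_bigr => z _ do under eq_bigr => u _ do rewrite expand.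
  under eq_bigr => z _ do rewrite sumrB big_split /= -mulr_suml sum_adj -mulr_sumr.
  rewrite sumrB big_split /= -mulr_sumr -/S SE exchange_big /=.
  under eq_bigr => z _ do under eq_bigr => u _ do rewrite adj_sym.
  under eq_bigr => z _ do rewrite -mulr_suml sum_adj.
  by rewrite SE; ring.
have term_ge0 z u : 0 <= (G u z)%:R * (g u - g z) ^+ 2.
  by rewrite mulr_ge0 ?ler0n ?sqr_ge0.
have := Q0 => /eqP; rewrite psumr_eq0 => [/allP /(_ z0)|]; last first.
  by move=> z _; apply: sumr_ge0.
rewrite mem_index_enum => /(_ isT) /=; rewrite psumr_eq0 // => /allP /(_ u0).
rewrite mem_index_enum adj0 => /(_ isT) /=; rewrite mul1r sqrf_eq0 subr_eq0.
by move/eqP.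
Qed.

Variables p q : T.
Hypotheses (connG : forall u z, connect G u z) (neq_pq : p != q) (nadj_pq : ~~ G p q).

(** For [f] in the kernel, [f u / root u] is constant along edges, hence on the whole connected
    graph. *)
Let kerL : (kermx L <= w)%MS.
Proof.
apply/rV_subP => f /sub_kermxP fL; pose g u := f 0 (enum_rank u) / root u.
suff fE : f = g p *: w by rewrite fE scalemx_sub.
apply/rowP => i; rewrite -(enum_valK i) mxE wE; set u := enum_val i.
suff -> : g p = g u by rewrite /g divfK.
have /connectP[s sP ->] := connG p u.
elim: s (p) sP => //= z s IHs y /andP[yz /IHs <-].
exact: normalized_laplacian_ker_adj.
Qed.

(** The entry at the nonadjacent pair [p], [q] forces [c = 0], while the entry at [p] and a
    neighbour [z] is nonzero. *)
Let nonclique mu c : L - mu%:M != c *: (w^T *m w).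
Proof.
have [z pz] : exists z, G p z.
  by have := valency_gt0 p; rewrite card_gt0 => /set0Pn[z]; rewrite inE; exists z.
have neq_pz : p != z by apply: contraTneq pz => <-; rewrite adj_irrefl.
apply/eqP => /matrixP Lclique; have entry u := Lclique (enum_rank p) (enum_rank u).
have {}entry u : p != u -> - ((G p u)%:R / (root p * root u)) = c * (root p * root u).
  move=> neq_pu; have := entry u; rewrite mxE LE [in RHS]mxE wwE => <-.
  by rewrite !mxE (inj_eq enum_rank_inj) (negPf neq_pu) mulr0n sub0r subr0.
have c0 : c = 0.
  have /eqP := entry q neq_pq; rewrite (negPf nadj_pq) mul0r oppr0 eq_sym.
  by rewrite !mulf_eq0 !(negPf (root_neq0 _)) !orbF => /eqP.
have /eqP := entry z neq_pz; rewrite c0 pz mul0r mul1r oppr_eq0 invr_eq0.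
by rewrite mulf_eq0 !(negPf (root_neq0 _)).
Qed.

Variables th1 th2 : R.
Let t := th1 * th2 / \sum_u deg u.

(** Multiplying the entry at [u], [z] by [root u * root z] clears all square roots; the product of
    the two adjacency terms becomes the sum of inverse valencies over common neighbours. *)
Let mxeq_entries :
  (L - th1%:M) *m (L - th2%:M) = t *: (w^T *m w) <->
  forall u z, \sum_(y in common_neighbors G u z) (deg y)^-1
    = t * (deg u * deg z) - (u == z)%:R * ((th1 - 1) * (th2 - 1) * deg u)
      + (G u z)%:R * (2 - th1 - th2).
Proof.
have entryE u z :
  root u * root z * ((L - th1%:M) *m (L - th2%:M)) (enum_rank u) (enum_rank z)
  = \sum_(y in common_neighbors G u z) (deg y)^-1
    + (u == z)%:R * ((th1 - 1) * (th2 - 1) * deg u) - (G u z)%:R * (2 - th1 - th2).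
  have shiftE th x y : (L - th%:M) (enum_rank x) (enum_rank y)
      = (1 - th) * (x == y)%:R - (G x y)%:R / (root x * root y).
    by rewrite mxE LE !mxE (inj_eq enum_rank_inj) -mulr_natr; ring.
  rewrite mxE sum_enum_rank mulr_sumr.
  under eq_bigr => y _.
    rewrite !shiftE.
    (* The summand is split so that the first two terms carry a delta in [y], which [sum_delta]
       collapses. *)
    rewrite (_ : _ * _ =
        root u * root z * ((1 - th1) * (u == y)%:R - (G u y)%:R / (root u * root y))
          * (1 - th2) * (y == z)%:R
        - (1 - th1) * (G y z)%:R * root u / root y * (y == u)%:R
        + (G u y && G z y)%:R / deg y).
      over.
    rewrite (eq_sym u) (adj_sym _ z) -mulnb natrM.
    move: (sqr_root y) (root_neq0 y) (root_neq0 u) (root_neq0 z).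
    move: (root y) (root u) (root z) => ? ? ? <- ? ? ?.
    by field; apply/and3P.
  rewrite big_split sumrB /= !sum_delta addrC -addrA; congr (_ + _).
    rewrite [RHS]big_mkcond; apply: eq_bigr => y _.
    by rewrite inE; case: (_ && _); rewrite ?mul1r ?mul0r.
  have [->|_] := eqVneq u z.
    rewrite adj_irrefl; move: (sqr_root z) (root_neq0 z).
    by move: (root z) => ? <- ?; field.
  have := root_neq0 u; have := root_neq0 z.
  by set a := root u; set b := root z => ? ?; rewrite mulr0n; field; apply/andP.
split=> [mxeq u z|entries].
  have := entryE u z; rewrite mxeq mxE wwE.
  move: (sqr_root u) (sqr_root z); move: (root u) (root z) => ? ? <- <- ?; lra.
apply/matrixP => i j; rewrite -(enum_valK i) -(enum_valK j).
set u := enum_val i; set z := enum_val j; rewrite [RHS]mxE wwE.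
have rr0 : root u * root z != 0 by rewrite mulf_neq0.
apply: (mulfI rr0); rewrite entryE entries.
move: (sqr_root u) (sqr_root z); move: (root u) (root z) => ? ? <- <-; ring.
Qed.

(** The constant [s = w w^T] is the sum of the valencies, so [t] is the scalar of the matrix
    identity. *)
Theorem three_Leigenvalues :
  distinct_Leigenvalues G [:: 0; th1; th2] <->
  forall u z, \sum_(y in common_neighbors G u z) (deg y)^-1
    = t * (deg u * deg z) - (u == z)%:R * ((th1 - 1) * (th2 - 1) * deg u)
      + (G u z)%:R * (2 - th1 - th2).
Proof.
have s0 : \sum_u deg u != 0.
  by rewrite gt_eqF // (bigD1 p) //= ltr_wpDr // sumr_ge0 // => u _; apply: ltW.
split=> [[_ eigL]|/mxeq_entries mxeq].
  apply/mxeq_entries; apply: (three_eigenvalues_mxeq normalized_laplacian_sym wL kerL ww s0).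
  by move=> e; rewrite -eigL.
exact: (mxeq_three_eigenvalues normalized_laplacian_sym wL kerL ww s0 nonclique mxeq).
Qed.

End NormalizedLaplacian.

(** * Valencies and common neighbours in the point-block graph *)

Lemma common_neighborsC (T : finType) (G : sgraph T) u z :
  common_neighbors G u z = common_neighbors G z u.
Proof. by apply/setP => w; rewrite !inE andbC. Qed.

Section PointBlockGraph.
Variables (R : realType) (P B : finType) (inc : P -> B -> bool).
Variables (v k lambda r b x y a c d : nat).
Hypotheses (hD : is_2design inc v k lambda) (hr : replication_number inc r).
Hypotheses (hb : #|B| = b) (hqs : quasi_symmetric inc x y).
Hypothesis hG2 : strongly_regular (block_graph inc y) b a c d.

Local Notation Gamma := (point_block_graph inc y).

Definition adjacent_blocks_at (p : P) (D : B) : {set B} :=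
  [set E | inc p E && block_adj inc y D E].

Lemma yx_neq0 : y%:R - x%:R != 0 :> R.
Proof.
by have [/eqP neq_xy _ _ _] := hqs; rewrite subr_eq0 eqr_nat eq_sym.
Qed.

(* Count in two ways the pairs [(E, q)] with [p] in [E] and [q] in the
   intersection of [D] and [E]. *)
Lemma card_adjacent_blocks_at p D :
  (y%:R - x%:R) * #|adjacent_blocks_at p D|%:R = lambda%:R * k%:R - x%:R * r%:R
    + (inc p D)%:R * (r%:R - lambda%:R - k%:R + x%:R) :> R.
Proof.
have [_ _ _ blockk pairl] := hD; have [neq_xy meetxy _ _] := hqs.
(* Only two sizes occur, so the meeting size is affine in the adjacency indicator; the last term
   corrects [E = D], where the size is [k]. *)
have meetE E : (meet_size inc D E)%:R = x%:R + (y%:R - x%:R) * (block_adj inc y D E)%:R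
   + (E == D)%:R * (k%:R - x%:R) :> R.
  rewrite /block_adj eq_sym; have [<-|neq_ED] := eqVneq E D.
    by rewrite /meet_size setIid blockk /= mulr0n mulr1n; ring.
  rewrite /= mulr0n; have [|->|->] := meetxy D E; first by rewrite eq_sym.
    by have /eqP/negPf-> := neq_xy; rewrite mulr0n; ring.
  by rewrite eqxx mulr1n; ring.
have pairE q : #|point_blocks inc p :&: point_blocks inc q|%:R
    = lambda%:R + (q == p)%:R * (r%:R - lambda%:R) :> R.
  have [->|neq_qp] := eqVneq q p; first by rewrite setIid hr mulr1n; ring.
  by rewrite pairl 1?eq_sym // mulr0n; ring.
have delta_sum (I : finType) (Q : pred I) (i : I) (e : R) :
    \sum_(j | Q j) (j == i)%:R * e = (Q i)%:R * e.
  rewrite big_mkcond (bigD1 i) //= eqxx big1 ?addr0 => [|j /negPf->]; last first.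
    by rewrite mul0r; case: ifP.
  by case: (Q i); rewrite ?mul0r.
have : \sum_(E | inc p E) (meet_size inc D E)%:R
     = \sum_(q | inc q D) #|point_blocks inc p :&: point_blocks inc q|%:R :> R.
  rewrite -!natr_sum; congr _%:R.
  transitivity (\sum_(E | inc p E) \sum_(q | inc q D && inc q E) 1)%N.
    by apply: eq_bigr => E _; rewrite sum1_card; apply: eq_card => q; rewrite !inE.
  rewrite (exchange_big_dep (fun q => inc q D)) /= => [|E q _ /andP[] //].
  apply: eq_bigr => q qD; rewrite -sum1_card; apply: eq_bigl => E.
  by rewrite !inE qD.
under eq_bigr => E _ do rewrite meetE.
under [in RHS]eq_bigr => q _ do rewrite pairE.
rewrite !big_split /= !delta_sum -mulr_sumr.
have -> : \sum_(E | inc p E) (block_adj inc y D E)%:R = #|adjacent_blocks_at p D|%:R :> R.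
  rewrite -natr_sum -big_mkcondr sum1_card; congr _%:R.
  by apply: eq_card => E; rewrite !inE.
have -> : \sum_(E | inc p E) x%:R = x%:R * r%:R :> R.
  rewrite sumr_const -(hr p) -[LHS]mulr_natr; congr (_ * _%:R).
  by apply: eq_card => E; rewrite !inE.
have -> : \sum_(q | inc q D) lambda%:R = lambda%:R * k%:R :> R.
  rewrite sumr_const -(blockk D) -[LHS]mulr_natr; congr (_ * _%:R).
  by apply: eq_card => q; rewrite !inE.
move=> ?; lra.
Qed.

Lemma point_degree p : valency Gamma (inl p) = r.
Proof.
rewrite /valency -sum1_card big_sumType /= big1 ?add0n => [|q]; last by rewrite inE.
rewrite (eq_bigl (inc p)) => [|D]; last by rewrite inE.
by rewrite sum1_card -(hr p); apply: eq_card => D; rewrite !inE.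
Qed.

Lemma block_degree D : valency Gamma (inr D) = (k + a)%N.
Proof.
have [_ _ _ blockk _] := hD; have [_ _ vala _] := hG2.
rewrite /valency -sum1_card big_sumType /= -(blockk D) -(vala D) {}/valency -!sum1_card.
by congr (_ + _)%N; apply: eq_bigl => z; rewrite !inE.
Qed.

Lemma sum_inv_valency (S : {set P + B}) :
  \sum_(z in S) (valency Gamma z)%:R^-1
  = #|[set p | inl p \in S]|%:R / r%:R
    + #|[set D | inr D \in S]|%:R / (k%:R + a%:R) :> R.
Proof.
rewrite big_sumType /=.
under eq_bigr => p _ do rewrite point_degree.
under [X in _ + X]eq_bigr => D _ do rewrite block_degree natrD.
by rewrite !sumr_const !mulr_natl !cardsE.
Qed.

Lemma sum_valency :
  \sum_u (valency Gamma u)%:R = v%:R * r%:R + b%:R * (k%:R + a%:R) :> R.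
Proof.
have [<- _ _ _ _] := hD; rewrite -hb big_sumType /=.
under eq_bigr => p _ do rewrite point_degree.
under [X in _ + X]eq_bigr => D _ do rewrite block_degree natrD.
by rewrite !sumr_const !mulr_natl.
Qed.

Lemma sum_inv_common_points p q :
  \sum_(z in common_neighbors Gamma (inl p) (inl q)) (valency Gamma z)%:R^-1
  = (if p == q then r%:R else lambda%:R) / (k%:R + a%:R) :> R.
Proof.
have [_ _ _ _ pairl] := hD.
rewrite sum_inv_valency (_ : [set _ | _] = set0) ?cards0 ?mul0r ?add0r; last first.
  by apply/setP => z; rewrite !inE.
rewrite (_ : [set _ | _] = point_blocks inc p :&: point_blocks inc q); last first.
  by apply/setP => z; rewrite !inE.
by have [->|/pairl->] := eqVneq p q; rewrite // setIid hr.
Qed.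

(** Points are pairwise nonadjacent, so the common neighbours are the blocks through [p] adjacent to
    [D], counted above. *)
Lemma sum_inv_common_point_block p D :
  \sum_(z in common_neighbors Gamma (inl p) (inr D)) (valency Gamma z)%:R^-1
  = (lambda%:R * k%:R - x%:R * r%:R + (inc p D)%:R * (r%:R - lambda%:R - k%:R + x%:R))
    / ((y%:R - x%:R) * (k%:R + a%:R)) :> R.
Proof.
rewrite sum_inv_valency (_ : [set _ | _] = set0) ?cards0 ?mul0r ?add0r; last first.
  by apply/setP => z; rewrite !inE.
rewrite (_ : [set _ | _] = adjacent_blocks_at p D); last first.
  by apply/setP => z; rewrite !inE.
by rewrite -card_adjacent_blocks_at -mulf_div divff ?yx_neq0 // mul1r.
Qed.

(** Common neighbours are the shared points, of valency [r], and the common neighbours in the block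
    graph, of valency [k + a]. Distinct nonadjacent blocks share [x] points by quasi-symmetry. *)
Lemma sum_inv_common_blocks D E :
  \sum_(z in common_neighbors Gamma (inr D) (inr E)) (valency Gamma z)%:R^-1
  = if D == E then k%:R / r%:R + a%:R / (k%:R + a%:R)
    else if block_adj inc y D E then y%:R / r%:R + c%:R / (k%:R + a%:R)
    else x%:R / r%:R + d%:R / (k%:R + a%:R) :> R.
Proof.
have [_ _ _ blockk _] := hD; have [_ _ vala cd] := hG2.
rewrite sum_inv_valency.
rewrite (_ : [set _ | _] = block_points inc D :&: block_points inc E); last first.
  by apply/setP => z; rewrite !inE.
rewrite (_ : [set _ | _] = common_neighbors (block_graph inc y) D E); last first.
  by apply/setP => z; rewrite !inE.
have [->|neq_DE] := eqVneq D E.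
  rewrite setIid blockk -(vala E) /valency; congr (_ + _%:R / _).
  by apply: eq_card => z; rewrite !inE andbb.
have [_ meetxy _ _] := hqs; rewrite cd //= -/(meet_size inc D E) /block_adj neq_DE /=.
by have [->|->] := meetxy _ _ neq_DE; [case: eqP => [->|]|rewrite eqxx].
Qed.

End PointBlockGraph.

(** * The seven equations *)

Theorem proposition4 (R : realType) (P B : finType) (inc : P -> B -> bool)
    (v k lambda r b x y a c d : nat)
    (hD : is_2design inc v k lambda)
    (hr : replication_number inc r)
    (hb : #|B| = b)
    (hqs : quasi_symmetric inc x y)
    (hG2 : strongly_regular (block_graph inc y) b a c d)
    (hbireg : biregular (point_block_graph inc y))
    (hpart : valency_partition (point_block_graph inc y)
             = [set point_part P B; block_part P B])
    (theta1 theta2 : R) :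
  distinct_Leigenvalues (point_block_graph inc y) [:: 0; theta1; theta2]
  <->
  let t := theta1 * theta2 / (v%:R * r%:R + b%:R * (k%:R + a%:R)) in
  r%:R / (k%:R + a%:R)
    = t * r%:R ^+ 2 - (theta1 - 1) * (theta2 - 1) * r%:R
  /\ lambda%:R / (k%:R + a%:R)
    = t * r%:R ^+ 2
  /\ k%:R / r%:R + a%:R / (k%:R + a%:R)
    = t * (k%:R + a%:R) ^+ 2 - (theta1 - 1) * (theta2 - 1) * (k%:R + a%:R)
  /\ x%:R / r%:R + d%:R / (k%:R + a%:R)
    = t * (k%:R + a%:R) ^+ 2
  /\ y%:R / r%:R + c%:R / (k%:R + a%:R)
    = t * (k%:R + a%:R) ^+ 2 + 2 - theta1 - theta2
  /\ (lambda%:R * k%:R - x%:R * r%:R) / ((y%:R - x%:R) * (k%:R + a%:R))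
    = t * r%:R * (k%:R + a%:R)
  /\ ((lambda%:R - 1) * (k%:R - 1) - (x%:R - 1) * (r%:R - 1))
      / ((y%:R - x%:R) * (k%:R + a%:R))
    = t * r%:R * (k%:R + a%:R) + 2 - theta1 - theta2.
Proof.
have [cardP /andP[k_ge2 lt_kv] lambda_gt0 blockk pairl] := hD.
have [neq_xy meetxy [D1 [E1 [neq1 meet1]]] [D2 [E2 [neq2 meet2]]]] := hqs.
have block_pt D : exists p, inc p D.
  have : (0 < #|block_points inc D|)%N by rewrite blockk ltnW.
  by rewrite card_gt0 => /set0Pn[p]; rewrite inE; exists p.
have [p0 inc0] := block_pt D1.
(* As [k < v], the block [D1] misses a point; [p0] and [q0] are then two distinct nonadjacent
   vertices. *)
have [q0 ninc0] : exists q, ~~ inc q D1.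
  apply/existsP; apply: contraLR lt_kv; rewrite negb_exists -leqNgt => /forallP allD1.
  rewrite -cardP -(blockk D1); apply/subset_leq_card/subsetP => q _.
  by rewrite inE -[inc q D1]negbK.
have neq_pq : p0 != q0 by apply: contraNneq ninc0 => <-.
(* Since [lambda >= 1], any two points are joined through a block, which gives connectedness. *)
have common_block p q : p != q -> exists2 D, inc p D & inc q D.
  move=> neq; have : (0 < #|point_blocks inc p :&: point_blocks inc q|)%N.
    by rewrite pairl.
  by rewrite card_gt0 => /set0Pn[D]; rewrite !inE => /andP[]; exists D.
have r_gt0 : (0 < r)%N.
  by rewrite -(hr p0) card_gt0; apply/set0Pn; exists D1; rewrite inE.
have valency_gt0 u : (0 < valency (point_block_graph inc y) u)%N.
  case: u => [p|D]; first by rewrite (point_degree y hr).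
  by rewrite (block_degree hD hG2) addn_gt0 (ltnW k_ge2).
have conn_pD p D : inc p D -> connect (point_block_graph inc y) (inl p) (inr D).
  by move=> pD; apply: connect1.
have conn_Dp p D : inc p D -> connect (point_block_graph inc y) (inr D) (inl p).
  by move=> pD; apply: connect1.
have conn_pq p q : connect (point_block_graph inc y) (inl p) (inl q).
  have [->|/common_block[D pD qD]] := eqVneq p q; first exact: connect0.
  exact: connect_trans (conn_pD _ _ pD) (conn_Dp _ _ qD).
have conn u z : connect (point_block_graph inc y) u z.
  suff conn_p p w : connect (point_block_graph inc y) (inl p) w.
    case: u => [p|D]; first exact: conn_p.
    have [p pD] := block_pt D; exact: connect_trans (conn_Dp _ _ pD) (conn_p _ _).
  case: w => [q|D]; first exact: conn_pq.
  have [q qD] := block_pt D; exact: connect_trans (conn_pq _ _) (conn_pD _ _ qD).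
have eq_inl p q : (inl p == inl q :> P + B) = (p == q) by [].
have eq_inr D E : (inr D == inr E :> P + B) = (D == E) by [].
have [fwd bwd] := three_Leigenvalues (p := inl p0) (q := inl q0)
  valency_gt0 conn neq_pq isT theta1 theta2.
have valP := point_degree y hr.
have valB := block_degree hD hG2.
move: fwd bwd; rewrite (sum_valency R hD hr hb hG2); set t := _ / (_ + _) => fwd bwd.
have ptptE := sum_inv_common_points R hD hr hG2.
have ptblE := sum_inv_common_point_block R hD hr hqs hG2.
have blblE := sum_inv_common_blocks R hD hr hqs hG2.
(* This matches the numerator of the seventh equation with the incident case of [ptblE]. *)
have incidentE : (lambda%:R - 1) * (k%:R - 1) - (x%:R - 1) * (r%:R - 1)
    = lambda%:R * k%:R - x%:R * r%:R + (r%:R - lambda%:R - k%:R + x%:R) :> R by ring.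
rewrite incidentE; split=> [/fwd eqs t0|].
  (* Each type of vertex pair has a witness: [D1], [E1] meet in [x] points, [D2], [E2] in [y], and
     [D1] contains [p0] but not [q0]. *)
  have adj1 : block_adj inc y D1 E1 = false.
    by rewrite /block_adj meet1; apply/andP => -[_ /eqP].
  have adj2 : block_adj inc y D2 E2 by rewrite /block_adj neq2 meet2 eqxx.
  have := eqs (inl p0) (inl p0); have := eqs (inl p0) (inl q0).
  have := eqs (inr D1) (inr D1); have := eqs (inr D1) (inr E1).
  have := eqs (inr D2) (inr E2).
  have := eqs (inl p0) (inr D1); have := eqs (inl q0) (inr D1).
  rewrite !ptptE !ptblE !blblE !valP !valB !eq_inl !eq_inr !eqxx /=.
  rewrite (negPf neq_pq) (negPf neq1) (negPf neq2) inc0 (negPf ninc0).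
  rewrite block_adj_irrefl adj1 adj2 natrD !(mulr0n, mulr1n, mul0r, mul1r, addr0).
  by move=> -> -> -> -> -> -> ->; rewrite /t0; do !split; ring.
move=> [e1 [e2 [e3 [e4 [e5 [e6 e7]]]]]]; apply: bwd.
(* The last two equations are merged through the incidence indicator, which is also adjacency in the
   graph. *)
have point_block p D : (lambda%:R * k%:R - x%:R * r%:R
      + (inc p D)%:R * (r%:R - lambda%:R - k%:R + x%:R)) / ((y%:R - x%:R) * (k%:R + a%:R))
    = t * r%:R * (k%:R + a%:R) + (inc p D)%:R * (2 - theta1 - theta2).
  case: (inc p D); first by rewrite !mul1r e7; ring.
  by rewrite !mul0r !addr0 e6.
case=> [p|D] [q|E].
- rewrite ptptE !valP eq_inl /= mulr0n.
  by case: eqP => _; rewrite ?mulr0n ?mulr1n ?e1 ?e2; ring.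
- by rewrite ptblE point_block valP valB natrD /= mulr0n; ring.
- by rewrite common_neighborsC ptblE point_block valP valB natrD /= mulr0n; ring.
rewrite blblE !valB natrD eq_inr /=; have [->|_] := eqVneq D E.
  by rewrite block_adj_irrefl mulr0n mulr1n e3; ring.
by case: (block_adj inc y D E); rewrite ?mulr0n ?mulr1n ?e4 ?e5; ring.
Qed.
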